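(* Let $k,\ell$ be positive integers. For every collection of $k$-element subsets $I_1,\dots,I_\ell\subset[k\ell]$ with $I_1\cup\cdots\cup I_\ell=[k\ell]$, the monomial $[I_1]\cdots[I_\ell]$ in the maximal minors of $A$ lies in the linear span (over $\mathbb{C}$) of the coefficients of the standard $B$-monomials in the Segre determinant $\mathrm{Seg}_{k,\ell}(A,B)$.
   Context: Let $n=k\ell$ and $[n]=\{1,\dots,n\}$. Let $A=(a_{ij})$ be a $k\times n$ matrix and $B=(b_{ij})$ an $\ell\times n$ matrix of indeterminates over $\mathbb{C}$, with columns $A_1,\dots,A_n$ and $B_1,\dots,B_n$. For $I\in\binom{[n]}{k}$, the bracket $[I]$ is the determinant of the submatrix of $A$ with columns $I$; for $J\in\binom{[n]}{\ell}$, $\langle J\rangle$ is the determinant of the submatrix of $B$ with columns $J$. The bracket algebras $\mathcal{B}_{k,n}\subset\mathbb{C}[a_{ij}]$ and $\mathcal{B}_{\ell,n}\subset\mathbb{C}[b_{ij}]$ are the subalgebras generated by the brackets $[I]$, respectively $\langle J\rangle$. The Segre determinant $\mathrm{Seg}_{k,\ell}(A,B)$ is the determinant of the $k\ell\times k\ell$ matrix whose $i$-th column is $A_i\otimes B_i\in\mathbb{C}^k\otimes\mathbb{C}^\ell$. It lies in $\mathcal{B}_{k,n}\otimes\mathcal{B}_{\ell,n}$, has degree $\ell$ in the brackets $[I]$ and degree $k$ in the brackets $\langle J\rangle$, and is multilinear in the columns of $A$ and in the columns of $B$. A monomial $\langle J_1\rangle\cdots\langle J_k\rangle$ is standard if,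 writing each $J_s$ in increasing order, stacking $J_1,\dots,J_k$ vertically and transposing gives a semi-standard Young tableau (an $\ell\times k$ rectangular tableau whose columns are $J_1,\dots,J_k$, with entries non-decreasing along rows and strictly increasing down columns). The standard monomials of degree $k$ using each index of $[n]$ exactly once form a basis of the multilinear degree-$k$ component of $\mathcal{B}_{\ell,n}$. The ''coefficients of the $B$-monomials'' are the elements of $\mathcal{B}_{k,n}$ that arise as coefficients when $\mathrm{Seg}_{k,\ell}(A,B)$ is expanded in this basis of standard $B$-monomials. *)

(* Defs.v *)
From HB Require Import structures.
From mathcomp Require Import all_boot all_order all_algebra.
From mathcomp Require Import reals.
From mathcomp Require Import complex mxtens mpoly.

Set Implicit Arguments.
Unset Strict Implicit.
Unset Printing Implicit Defensive.

Import GRing.Theory.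
Local Open Scope ring_scope.

(* The index set [n] is 'I_n, so indices start at 0. *)

Definition ksubset (k n : nat) := {I : {set 'I_n} | #|I| == k}.

(* The r-th smallest element of I: enum_val lists a set of ordinals in
   increasing order. *)
Definition ksubset_nth (k n : nat) (I : ksubset k n) (r : 'I_k) : 'I_n :=
  enum_val (cast_ord (esym (eqP (valP I))) r).

Definition bracket (S : comNzRingType) (k n : nat) (M : 'M[S]_(k, n))
    (I : ksubset k n) : S :=
  \det (colsub (ksubset_nth I) M).

Definition bracket_monomial (S : comNzRingType) (k n d : nat)
    (M : 'M[S]_(k, n)) (I : 'I_d -> ksubset k n) : S :=
  \prod_(s < d) bracket M (I s).

Definition generic_mx (S : comNzRingType) (k n : nat) :
    'M[{mpoly S[k * n]}]_(k, n) :=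
  \matrix_(i, j) 'X_(mxvec_index i j).

(* The i-th column is the Kronecker product of the i-th columns of A and B. *)
Definition segre_mx (S : comNzRingType) (k l : nat)
    (A : 'M[S]_(k, k * l)) (B : 'M[S]_(l, k * l)) : 'M[S]_(k * l) :=
  \matrix_(r, i) (col i A *t col i B) r ord0.

(* S[a, b] is represented as S[a][b]: polynomials in the b_ij with
   coefficients in S[a].  The matrix of the b_ij is then generic over S[a],
   and the matrix of the a_ij consists of constant polynomials. *)
Definition segre_det (S : comNzRingType) (k l : nat) :
    {mpoly {mpoly S[k * (k * l)]}[l * (k * l)]} :=
  \det (segre_mx
          (map_mx (fun a => a%:MP_[l * (k * l)]) (generic_mx S k (k * l)))
          (generic_mx {mpoly S[k * (k * l)]} l (k * l))).

Definition semistandard (m p n : nat) (T : 'M['I_n]_(m, p)) : bool :=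
  [forall r : 'I_m, forall s : 'I_p, forall s' : 'I_p,
     (s <= s')%N ==> (T r s <= T r s')%N] &&
  [forall r : 'I_m, forall r' : 'I_m, forall s : 'I_p,
     (r < r')%N ==> (T r s < T r' s)%N].

(* The tableau whose columns are J_1, ..., J_d. *)
Definition tableau (l n d : nat) (J : {ffun 'I_d -> ksubset l n}) :
    'M['I_n]_(l, d) :=
  \matrix_(r, s) ksubset_nth (J s) r.

Definition standard_multilinear (l n d : nat)
    (J : {ffun 'I_d -> ksubset l n}) : bool :=
  semistandard (tableau J) &&
  [forall x, #|[set s | x \in val (J s)]| == 1%N].

(* c is the family of coefficients of the Segre determinant in the standard
   B-monomials.  Multilinear standard monomials are a basis, so there is
   exactly one such family on the standard J; in particular the c J lie in
   the bracket algebra of A and need not be required to.  The values of c at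
   other J are irrelevant. *)
Definition segre_coefficients (S : comNzRingType) (k l : nat)
    (c : {ffun 'I_k -> ksubset l (k * l)} -> {mpoly S[k * (k * l)]}) : Prop :=
  segre_det S k l =
  \sum_(J | standard_multilinear J)
     c J *: bracket_monomial
              (generic_mx {mpoly S[k * (k * l)]} l (k * l)) J.

(* Main.v *)
Require Import Defs.
From HB Require Import structures.
From mathcomp Require Import all_boot all_order all_algebra.
From mathcomp Require Import reals.
From mathcomp Require Import complex mxtens mpoly.
From mathcomp Require Import fingroup perm.

Set Implicit Arguments.
Unset Strict Implicit.
Unset Printing Implicit Defensive.

Import GRing.Theory.
Local Open Scope ring_scope.

(** Specialise $B$ to the 0-1 matrix whose column $B_i$ is the basis vector $e_s$
    with $i \in I_s$.  As the sets $I_s$ partition $[n]$, the Segre matrix becomes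
    block diagonal up to permutations of rows and columns, with diagonal blocks the
    submatrices of $A$ on the columns $I_s$, so the Segre determinant becomes
    $\pm [I_1] \cdots [I_\ell]$.  Specialising each standard $B$-monomial to a scalar
    turns the expansion into the required linear combination. *)

Lemma det_castmx (S : comNzRingType) (m n : nat) (e : m = n) (A : 'M[S]_m) :
  \det (castmx (e, e) A) = \det A.
Proof. by case: n / e; rewrite castmx_id. Qed.

Lemma det_mxdiag (S : comNzRingType) (p : nat) (p_ : 'I_p -> nat)
    (B : forall i, 'M[S]_(p_ i)) :
  \det (\mxdiag_i B i) = \prod_i \det (B i).
Proof.
elim: p p_ B => [|p IHp] p_ B.
  (* The size is an empty sum, so the matrix is generalised before its size is rewritten to $0$. *)
  by move: (\mxdiag_i B i); rewrite !big_ord0 => M; rewrite det_mx00.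
by rewrite mxdiag_recl det_castmx det_ublock IHp big_ord_recl.
Qed.

(** Injections between ordinals of equal size are permutations, and each contributes its sign.
    Keeping [m] and [n] apart lets the lemma reindex by $\sum_{s<l} k$, which equals $kl$ only
    propositionally. *)
Lemma det_mxsub_inj (S : comNzRingType) (m n : nat) (f g : 'I_m -> 'I_n)
    (A : 'M[S]_n) :
  m = n -> injective f -> injective g ->
  exists b : bool, \det (mxsub f g A) = (-1) ^+ b * \det A.
Proof.
move=> e; case: n / e in f g A * => f_inj g_inj.
exists (odd_perm (perm f_inj) (+) odd_perm (perm g_inj)).
have -> : mxsub f g A = row_perm (perm f_inj) (col_perm (perm g_inj) A).
  by apply/matrixP => i j; rewrite !mxE !permE.
rewrite row_permE col_permE !det_mulmx !det_perm odd_permV signr_addb.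
by rewrite -mulrA [\det A * _]mulrC.
Qed.

Lemma map_mx_bracket (S S' : comNzRingType) (f : {rmorphism S -> S'})
    (k n : nat) (M : 'M[S]_(k, n)) (I : ksubset k n) :
  f (bracket M I) = bracket (map_mx f M) I.
Proof. by rewrite /bracket -map_mxsub det_map_mx. Qed.

Lemma map_mx_bracket_monomial (S S' : comNzRingType) (f : {rmorphism S -> S'})
    (k n d : nat) (M : 'M[S]_(k, n)) (I : 'I_d -> ksubset k n) :
  f (bracket_monomial M I) = bracket_monomial (map_mx f M) I.
Proof.
by rewrite rmorph_prod; apply: eq_bigr => s _; rewrite map_mx_bracket.
Qed.

Lemma map_segre_mx (S S' : comNzRingType) (f : {rmorphism S -> S'})
    (k l : nat) (A : 'M[S]_(k, k * l)) (B : 'M[S]_(l, k * l)) :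
  map_mx f (segre_mx A B) = segre_mx (map_mx f A) (map_mx f B).
Proof. by apply/matrixP => i j; rewrite !mxE rmorphM. Qed.

Lemma mem_ksubset_nth (k n : nat) (I : ksubset k n) (r : 'I_k) :
  ksubset_nth I r \in val I.
Proof. exact: enum_valP. Qed.

Lemma ksubset_nthP (k n : nat) (I : ksubset k n) (x : 'I_n) :
  reflect (exists r, x = ksubset_nth I r) (x \in val I).
Proof.
apply: (iffP idP) => [Ix | [r ->]]; last exact: mem_ksubset_nth.
exists (cast_ord (eqP (valP I)) (enum_rank_in Ix x)).
by rewrite /ksubset_nth cast_ordK enum_rankK_in.
Qed.

(** By counting: $l$ sets of size $k$ that cover $kl$ points give a surjection between finite sets
    of equal cardinality. Injectivity encodes the disjointness of the $I_s$. *)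
Lemma ksubset_cover_inj (k l : nat) (I : 'I_l -> ksubset k (k * l)) :
  \bigcup_(s < l) val (I s) = [set: 'I_(k * l)] ->
  injective (fun u : 'I_l * 'I_k => ksubset_nth (I u.1) u.2).
Proof.
move=> hI; set g := fun u => _.
have g_surj x : x \in codom g.
  have /bigcupP[s _ /ksubset_nthP[r ->]] : x \in \bigcup_(s < l) val (I s).
    by rewrite hI inE.
  by apply/codomP; exists (s, r).
have /image_injP g_inj : #|image g predT| == #|{: 'I_l * 'I_k}|.
  rewrite card_prod !card_ord [X in _ == X]mulnC -[X in _ == X]card_ord.
  by apply/eqP/eq_card => x; rewrite [LHS]g_surj inE.
by move=> u v; exact: g_inj.
Qed.

Definition indicator_mx (S : comNzRingType) (k l n : nat)
    (I : 'I_l -> ksubset k n) : 'M[S]_(l, n) :=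
  \matrix_(s, i) (i \in val (I s))%:R.

Lemma det_segre_mx_indicator (S : comNzRingType) (k l : nat)
    (A : 'M[S]_(k, k * l)) (I : 'I_l -> ksubset k (k * l)) :
  \bigcup_(s < l) val (I s) = [set: 'I_(k * l)] ->
  exists b : bool,
    bracket_monomial A I = (-1) ^+ b * \det (segre_mx A (indicator_mx S I)).
Proof.
move=> /ksubset_cover_inj I_inj.
(* An index of the block matrix stands for a pair $(s, r)$: block $s$, position $r$. Its row is the
   coordinate $e_r \otimes e_s$, its column the $r$-th element of $I_s$. *)
pose row_of (i : 'I_(\sum_(s < l) k)) : 'I_(k * l) :=
  mxtens_index (tagnat.sig2 i : 'I_k, tagnat.sig1 i).
pose col_of (i : 'I_(\sum_(s < l) k)) : 'I_(k * l) :=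
  ksubset_nth (I (tagnat.sig1 i)) (tagnat.sig2 i).
have sig_inj (i j : 'I_(\sum_(s < l) k)) :
    tagnat.sig1 i = tagnat.sig1 j ->
    tagnat.sig2 i = tagnat.sig2 j :> 'I_k -> i = j.
  move=> e1 e2; apply: ord_inj; apply/eqP.
  by rewrite -(tagnat.sig2K i) -(tagnat.sig2K j) tagnat.eq_Rank e1 e2 !eqxx.
have row_inj : injective row_of.
  by move=> i j /(can_inj (@mxtens_indexK k l)) [e2 e1]; apply: sig_inj => //;
    apply: val_inj.
have col_inj : injective col_of.
  move=> i j eq_ij.
  have [] := I_inj (_, _) (_, _) eq_ij; exact: sig_inj.
have size_eq : (\sum_(s < l) k = k * l)%N.
  by rewrite sum_nat_const card_ord mulnC.
have [b detE] := det_mxsub_inj (segre_mx A (indicator_mx S I))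
  size_eq row_inj col_inj.
exists b; rewrite -detE /bracket_monomial.
under eq_bigr do rewrite /bracket.
rewrite -(@det_mxdiag _ _ (fun=> k)); congr (\det _).
apply/matrixP => i j; rewrite !mxE !mxtens_indexK /=.
(* By disjointness, an element of $I_{s'}$ lies in $I_s$ only if $s = s'$, so the entries outside
   the diagonal blocks vanish. *)
have -> : (col_of j \in val (I (tagnat.sig1 i))) =
    (tagnat.sig1 i == tagnat.sig1 j).
  apply/ksubset_nthP/eqP => [[r eq_r] | ->]; last by exists (tagnat.sig2 j).
  by have [] := I_inj (_, _) (_, _) eq_r.
case: (eqVneq (tagnat.sig1 i)) => [eq_ij | _]; last by rewrite mulr0 mxE.
by rewrite mulr1 conform_mx_id mxE /col_of eq_ij.
Qed.

Theorem theorem6p2 (R : realType) (k l : nat) (hk : (0 < k)%N) (hl : (0 < l)%N)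
  (c : {ffun 'I_k -> ksubset l (k * l)} -> {mpoly R[i][k * (k * l)]})
  (hc : segre_coefficients c)
  (I : 'I_l -> ksubset k (k * l))
  (hI : \bigcup_(s < l) val (I s) = [set: 'I_(k * l)]) :
  exists mu : {ffun 'I_k -> ksubset l (k * l)} -> R[i],
    bracket_monomial (generic_mx R[i] k (k * l)) I =
    \sum_(J | standard_multilinear J) mu J *: c J.
Proof.
pose P := {mpoly R[i][k * (k * l)]}; pose B0 := indicator_mx R[i] I.
have [b ->] := det_segre_mx_indicator (generic_mx R[i] k (k * l)) hI.
(* Evaluation at [B0] fixes the coefficient ring [P], hence the $a_{ij}$ and every [c J]; only the
   $b_{ij}$ are specialised. *)
pose ev : {rmorphism {mpoly P[l * (k * l)]} -> P} :=
  meval (fun x => mxvec (map_mx (fun a => a%:MP_[k * (k * l)]) B0) ord0 x).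
have evB : map_mx ev (generic_mx P l (k * l)) = indicator_mx P I.
  apply/matrixP => s i; rewrite !mxE /= mevalXU mxvecE !mxE.
  by case: (_ \in _); rewrite ?mpolyC1 ?mpolyC0.
have evA : map_mx ev (map_mx (fun a => a%:MP_[l * (k * l)])
    (generic_mx R[i] k (k * l))) = generic_mx R[i] k (k * l).
  by apply/matrixP => r i; rewrite !mxE /= mevalC.
have <- : ev (segre_det R[i] k l) =
    \det (segre_mx (generic_mx R[i] k (k * l)) (indicator_mx P I)).
  by rewrite -det_map_mx map_segre_mx evA evB.
(* The weight of [c J] is the value of the $B$-monomial at [B0], with the sign from reordering rows
   and columns. *)
exists (fun J => (-1) ^+ b * bracket_monomial B0 J).
rewrite hc rmorph_sum mulr_sumr; apply: eq_bigr => J _.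
rewrite /= mevalZ.
(* Since [B0] has entries in $\mathbb{C}$, this value is a constant polynomial, so multiplying [c J]
   by it is scaling over $\mathbb{C}$. *)
have -> : ev (bracket_monomial (generic_mx P l (k * l)) J) =
   (bracket_monomial B0 J)%:MP.
  rewrite map_mx_bracket_monomial evB.
  rewrite (map_mx_bracket_monomial (@mpolyC (k * (k * l)) R[i])).
  congr bracket_monomial; apply/matrixP => s i; rewrite !mxE.
  by rewrite rmorph_nat.
by rewrite [c J * _]mulrC mul_mpolyC -scalerA mulr_sign scaler_sign.
Qed.
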